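(* Consider an operational theory, a preparation procedure $P$, a measurement procedure $M$ with finitely many outcomes $k$, and an observable $\mathcal{A}=\{(a_k,k|M)\}_k$ with $a_k>0$ for all $k$; put $a_{max}=\max_k a_k$. Let $T_t$ be a transformation procedure which is a sequential composition $T_t=T_{t_2}\circ T_{t_1}$ of two transformation procedures. Suppose that there are transformation procedures $T_t^*, T_{t_2}^*, T_1', T_2'$ and numbers $p_{d_1},p_{d_2}\in[0,1]$ such that the following operational equivalences hold: $$\tfrac12 T_t+\tfrac12 T_t^*\simeq (1-p_{d_1})T_{t_2}+p_{d_1}T_1',$$ $$\tfrac12 T_{t_2}+\tfrac12 T_{t_2}^*\simeq (1-p_{d_2})T_{\mathrm{id}}+p_{d_2}T_2'.$$ If there is a noncontextual ontological model reproducing the statistics, then $$-4a_{max}b_-\le \langle\Delta\mathcal{A}\rangle\le 2a_{max}b_+,$$ where $b_-=p_{d_1}+3p_{d_2}-3p_{d_1}p_{d_2}$, $b_+=p_{d_1}+2p_{d_2}-2p_{d_1}p_{d_2}$ and $$\langle\Delta\mathcal{A}\rangle=\sum_k a_k\bigl(p(k|M,T_t,P)-p(k|M,P)\bigr).$$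
   Context: Operational theory: preparation procedures $P$, transformation procedures $T$, measurement procedures $M$ with outcomes $k$, and probabilities $p(k|M,T,P)$. $T_2\circ T_1$ means doing $T_1$ then $T_2$. The identity procedure $T_{\mathrm{id}}$ satisfies $p(k|M,T_{\mathrm{id}},P)=p(k|M,P)$ for all $P$ and $k|M$. A convex mixture $wT+(1-w)T'$ is the procedure of performing $T$ with probability $w$ and $T'$ with probability $1-w$. Two transformation procedures are operationally equivalent, $T\simeq T'$, if $p(k|M,T,P)=p(k|M,T',P)$ for all preparations $P$ and all measurement effects $k|M$. Ontological model: a measurable space $\Lambda$; a probability measure $\mu_P$ on $\Lambda$ for each preparation; a Markov kernel (stochastic matrix if $\Lambda$ is finite) $\Gamma_T(d\lambda'|\lambda)$ for each transformation, with $\Gamma_{T_{\mathrm{id}}}(\cdot|\lambda)=\delta_\lambda$ and with convex mixtures of procedures represented by the same convex mixtures of kernels; measurable response functions $\xi_{k|M}:\Lambda\to[0,1]$ with $\sum_k\xi_{k|M}=1$; such that $$p(k|M,T,P)=\int_\Lambda\int_\Lambda \xi_{k|M}(\lambda')\,\Gamma_T(d\lambda'|\lambda)\,d\mu_P(\lambda),\qquad p(k|M,P)=\int_\Lambda\xi_{k|M}(\lambda)\,d\mu_P(\lambda).$$ The model is (generalized) noncontextual if operationally equivalent procedures are represented by equal objects; in particular $T\simeq T'$ implies $\Gamma_T=\Gamma_{T'}$ (equality of matrices for finite $\Lambda$; in general up to sets of measure zero, i.e. $\Gamma_T(\cdot|\lambda)=\Gamma_{T'}(\cdot|\lambda)$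 for $\mu_P$-almost every $\lambda$). *)

(* Defs.v *)
From HB Require Import structures.
From mathcomp Require Import all_boot all_order all_algebra.
From mathcomp Require Import all_classical all_reals all_analysis.

Set Implicit Arguments.
Unset Strict Implicit.
Unset Printing Implicit Defensive.

Import Order.TTheory GRing.Theory Num.Theory.
Local Open Scope classical_set_scope.
Local Open Scope ring_scope.

(* [prob k P] is p(k|M,P) and [probT k T P] is p(k|M,T,P).
   [trans_comp T2 T1] is the procedure "T1, then T2"; no law relating
   it to the statistics is imposed, so that every operational theory is an
   instance.
   [trans_mix w T T'] is the procedure w T + (1 - w) T'; it is only meaningful
   for 0 <= w <= 1.
   Outcome sets may be infinite, hence the normalizations as [esum]. *)
Record operational_theory (R : realType) := OperationalTheory {
  prep : Type ;
  trans : Type ;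
  meas : Type ;
  outcome : meas -> choiceType ;
  prob : forall M : meas, outcome M -> prep -> R ;
  probT : forall M : meas, outcome M -> trans -> prep -> R ;
  id_trans : trans ;
  trans_comp : trans -> trans -> trans ;
  trans_mix : R -> trans -> trans -> trans ;
  prob_ge0 : forall (M : meas) (k : outcome M) (P : prep), 0 <= prob k P ;
  prob_sum1 : forall (M : meas) (P : prep),
    \esum_(k in [set: outcome M]) (prob k P)%:E = 1%E ;
  probT_ge0 : forall (M : meas) (k : outcome M) (T : trans) (P : prep),
    0 <= probT k T P ;
  probT_sum1 : forall (M : meas) (T : trans) (P : prep),
    \esum_(k in [set: outcome M]) (probT k T P)%:E = 1%E ;
  probT_id : forall (M : meas) (k : outcome M) (P : prep),
    probT k id_trans P = prob k P ;
  probT_mix : forall (w : R) (T T' : trans), 0 <= w <= 1 ->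
    forall (M : meas) (k : outcome M) (P : prep),
    probT k (trans_mix w T T') P = w * probT k T P + (1 - w) * probT k T' P
}.

Arguments prob {R} _ {M} k P.
Arguments probT {R} _ {M} k T P.
Arguments id_trans {R} _.
Arguments trans_comp {R _} T2 T1.
Arguments trans_mix {R _} w T T'.

Section operational_equivalence.
Context {R : realType} {O : operational_theory R}.

Definition trans_equiv (T T' : trans O) : Prop :=
  forall (P : prep O) (M : meas O) (k : outcome M),
    probT O k T P = probT O k T' P.

(* By [probT_id], the case T = T_id of the next two definitions is the equality
   of the statistics p(k|M,P) without transformation. *)
Definition prep_equiv (P P' : prep O) : Prop :=
  forall (T : trans O) (M : meas O) (k : outcome M),
    probT O k T P = probT O k T P'.

Definition effect_equiv (M M' : meas O) (k : outcome M) (k' : outcome M') :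
    Prop :=
  forall (T : trans O) (P : prep O), probT O k T P = probT O k' T P.

End operational_equivalence.

(* Two measures are compared on measurable sets only, since the value of a
   measure outside the sigma-algebra is irrelevant. *)
Record ontological_model (R : realType) (O : operational_theory R)
    (d : measure_display) (L : measurableType d) := OntologicalModel {
  mu : prep O -> probability L R ;
  Gamma : trans O -> R.-pker L ~> L ;
  xi : forall M : meas O, outcome M -> L -> R ;
  xi_measurable : forall (M : meas O) (k : outcome M),
    measurable_fun [set: L] (xi k) ;
  xi_itv : forall (M : meas O) (k : outcome M) (l : L), 0 <= xi k l <= 1 ;
  xi_sum1 : forall (M : meas O) (l : L),
    \esum_(k in [set: outcome M]) (xi k l)%:E = 1%E ;
  Gamma_id : forall (l : L) (A : set L), measurable A ->
    Gamma (id_trans O) l A = \d_l A ;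
  Gamma_mix : forall (w : R) (T T' : trans O), 0 <= w <= 1 ->
    forall (l : L) (A : set L), measurable A ->
    Gamma (trans_mix w T T') l A
      = (w%:E * Gamma T l A + (1 - w)%:E * Gamma T' l A)%E ;
  reproduces_prob : forall (M : meas O) (k : outcome M) (P : prep O),
    (prob O k P)%:E = (\int[mu P]_l (xi k l)%:E)%E ;
  reproduces_probT :
    forall (M : meas O) (k : outcome M) (T : trans O) (P : prep O),
    (probT O k T P)%:E
      = (\int[mu P]_l (\int[Gamma T l]_l' (xi k l')%:E))%E
}.

Arguments mu {R O d L} _ P.
Arguments Gamma {R O d L} _ T.
Arguments xi {R O d L} _ {M} k _.

Section noncontextuality.
Context {R : realType} {O : operational_theory R}.
Context {d : measure_display} {L : measurableType d}.
Variable m : ontological_model O L.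

Definition prep_noncontextual : Prop :=
  forall P P' : prep O, prep_equiv P P' ->
    forall A : set L, measurable A -> mu m P A = mu m P' A.

(* On a finite L, equality of the stochastic matrices implies this
   almost-everywhere equality. *)
Definition trans_noncontextual : Prop :=
  forall T T' : trans O, trans_equiv T T' ->
    forall P : prep O, {ae mu m P, forall l : L,
      forall A : set L, measurable A -> Gamma m T l A = Gamma m T' l A}.

Definition meas_noncontextual : Prop :=
  forall (M M' : meas O) (k : outcome M) (k' : outcome M'),
    effect_equiv k k' ->
    forall P : prep O, {ae mu m P, forall l : L, xi m k l = xi m k' l}.

Definition noncontextual : Prop :=
  [/\ prep_noncontextual, trans_noncontextual & meas_noncontextual].

End noncontextuality.

Section observable.
Context {R : realType} {O : operational_theory R} {M : meas O}.
Variable a : outcome M -> R.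

(* For finitely many outcomes and a > 0 (the set of outcomes is nonempty by
   [prob_sum1]) this is the maximum of the a k: the default value 0 is never
   reached. *)
Definition obs_max : R := \big[Num.max/0]_(k \in [set: outcome M]) a k.

Definition obs_change (T : trans O) (P : prep O) : R :=
  \sum_(k \in [set: outcome M]) a k * (probT O k T P - prob O k P).

End observable.

(* Main.v *)
(* Fix a point l. Comparing kernels at l on a measurable set A that does not
   contain l, the second equivalence bounds Gamma_{t2}(A|l) by 2 pd2, and then
   the first bounds Gamma_t(A|l) by 2 bplus. For f = sum_k a_k xi_k, with values
   in [0, amax], take A = {f > f(l)} and A = {f < f(l)}: the integral of f
   against Gamma_t(.|l) differs from f(l) by at most 2 amax bplus. Integrating
   over l bounds |<Delta A>| by 2 amax bplus, and bplus <= 2 bminus. *)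

Require Import Defs.
From HB Require Import structures.
From mathcomp Require Import all_boot all_order all_algebra.
From mathcomp Require Import all_classical all_reals all_analysis.
From mathcomp Require Import finmap measurable_realfun ring lra.

Set Implicit Arguments.
Unset Strict Implicit.
Unset Printing Implicit Defensive.

Import Order.TTheory GRing.Theory Num.Theory.
Local Open Scope classical_set_scope.
Local Open Scope ring_scope.

Lemma ge0_integral_wsum (d : measure_display) (T : measurableType d)
    (R : realType) (nu : {measure set T -> \bar R}) (I : Type) (s : seq I)
    (a : I -> R) (f : I -> T -> \bar R) :
  (forall i, 0 <= a i) -> (forall i x, (0 <= f i x)%E) ->
  (forall i, measurable_fun [set: T] (f i)) ->
  (\int[nu]_x (\sum_(i <- s) (a i)%:E * f i x)
    = \sum_(i <- s) (a i)%:E * \int[nu]_x f i x)%E.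
Proof.
move=> a0 f0 mf; rewrite ge0_integral_sum//.
- by apply: eq_bigr => i _; rewrite ge0_integralZl_EFin.
- by move=> i; exact: measurable_funeM.
- by move=> i x _; rewrite mule_ge0// lee_fin.
Qed.

(** The total mass is one, so the constant [c] integrates to itself. This turns the
    almost-everywhere kernel bounds into bounds on expectation values. *)
Lemma ae_ge0_le_integral_addr (d : measure_display) (T : measurableType d)
    (R : realType) (nu : probability T R) (g h : T -> \bar R) (c : R) :
  0 <= c -> measurable_fun [set: T] g -> measurable_fun [set: T] h ->
  (forall x, (0 <= g x)%E) -> (forall x, (0 <= h x)%E) ->
  {ae nu, forall x, (g x <= h x + c%:E)%E} ->
  (\int[nu]_x g x <= \int[nu]_x h x + c%:E)%E.
Proof.
move=> c0 mg mh g0 h0 gh.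
have -> : (\int[nu]_x h x + c%:E = \int[nu]_x (h x + c%:E))%E.
  rewrite ge0_integralD//; congr (_ + _)%E.
  by rewrite integral_cst// [X in (_ * X)%E](_ : _ = 1%E) ?mule1//;
    exact: probability_setT.
apply: ae_ge0_le_integral => //.
- by move=> x _; rewrite adde_ge0// lee_fin.
- exact: emeasurable_funD.
- by apply: filterS gh.
Qed.

(** Pointwise [f <= g + c * \1_A]: off [A] already [f <= g], and on [A] the term [c] alone dominates
    [f], as [g] is nonnegative. *)
Lemma integral_le_add_bound (d : measure_display) (T : measurableType d)
    (R : realType) (nu : {measure set T -> \bar R}) (f g : T -> R) (c : R)
    (A : set T) :
  measurable_fun [set: T] f -> measurable_fun [set: T] g -> measurable A ->
  (forall x, 0 <= f x) -> (forall x, 0 <= g x) -> 0 <= c ->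
  (forall x, f x <= c) -> (forall x, ~ A x -> f x <= g x) ->
  (\int[nu]_x (f x)%:E <= \int[nu]_x (g x)%:E + c%:E * nu A)%E.
Proof.
move=> mf mg mA f0 g0 c0 fc fg.
have mI : measurable_fun [set: T] (fun x => (c * \1_A x)%:E).
  apply/measurable_EFinP; apply: measurable_funM; first exact: measurable_cst.
  exact: measurable_indic.
have -> : (c%:E * nu A = \int[nu]_x (c * \1_A x)%:E)%E.
  under eq_integral do rewrite EFinM.
  rewrite ge0_integralZl_EFin//; first by rewrite integral_indic// setIT.
  by apply/measurable_EFinP; exact: measurable_indic.
rewrite -ge0_integralD//; first last.
- by move=> x _; rewrite lee_fin mulr_ge0.
- exact/measurable_EFinP.
- by move=> x _; rewrite lee_fin.
apply: ge0_le_integral => //.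
- by move=> x _; rewrite lee_fin.
- exact/measurable_EFinP.
- by apply: emeasurable_funD => //; exact/measurable_EFinP.
- move=> x _; rewrite -EFinD lee_fin indicE.
  have [_|/negP xA] := boolP (x \in A); first by rewrite mulr1 ler_wpDl.
  by rewrite mulr0 addr0; apply: fg => Ax; apply: xA; exact: mem_set.
Qed.

(* The sets A avoiding l stand in for the complement of {l}, as singletons need
   not be measurable. *)
Lemma integral_near_point (d : measure_display) (T : measurableType d)
    (R : realType) (nu : {measure set T -> \bar R}) (f : T -> R) (C b : R)
    (l : T) :
  nu [set: T] = 1%E -> measurable_fun [set: T] f ->
  (forall x, 0 <= f x <= C) ->
  (forall A, measurable A -> ~ A l -> (nu A <= b%:E)%E) ->
  (\int[nu]_x (f x)%:E <= (f l)%:E + (C * b)%:E /\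
   (f l)%:E <= \int[nu]_x (f x)%:E + (C * b)%:E)%E.
Proof.
move=> nu1 mf f0C nub.
have C0 : 0 <= C by have /andP[] := f0C l; exact: le_trans.
have f0 x : 0 <= f x by have /andP[] := f0C x.
have fC x : f x <= C by have /andP[] := f0C x.
have int_cst : (\int[nu]_x (cst (f l) x)%:E = (f l)%:E)%E.
  by rewrite (integral_cst nu measurableT (f l)%:E) nu1 mule1.
have tail A : measurable A -> ~ A l -> (C%:E * nu A <= (C * b)%:E)%E.
  by move=> mA Al; rewrite EFinM lee_wpmul2l ?lee_fin//; exact: nub.
have mlt (g h : T -> R) : measurable_fun [set: T] g ->
    measurable_fun [set: T] h -> measurable [set x | g x < h x].
  move=> /measurable_EFinP mg /measurable_EFinP mh.
  by rewrite -[X in measurable X]setTI; exact: (measurable_lte measurableT mg mh).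
have mc : measurable_fun [set: T] (cst (f l) : T -> R) by exact: measurable_cst.
split.
(* Strictness keeps [l] out of [A], so [tail] applies. The constant [f l] is compared with [f]
   through its own integral, which is [f l] since [nu] has mass one. *)
- pose A := [set x | f l < f x]; have mA : measurable A := mlt _ _ mc mf.
  apply: le_trans (_ : _ <= (f l)%:E + C%:E * nu A)%E _; last first.
    by rewrite leeD2l//; apply: tail => //; rewrite /A /= ltxx.
  rewrite -{1}int_cst; apply: integral_le_add_bound => // x /=; first exact: f0.
  by move=> /negP; rewrite -leNgt.
- pose A := [set x | f x < f l]; have mA : measurable A := mlt _ _ mf mc.
  apply: le_trans (_ : _ <= \int[nu]_x (f x)%:E + C%:E * nu A)%E _; last first.
    by rewrite leeD2l//; apply: tail => //; rewrite /A /= ltxx.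
  rewrite -{1}int_cst; apply: integral_le_add_bound => // x /=.
  + exact: f0.
  + exact: fC.
  + by move=> /negP; rewrite -leNgt.
Qed.

Section model.
Context {R : realType} {O : operational_theory R}.
Context {d : measure_display} {L : measurableType d}.
Variable m : ontological_model O L.

(** Replaces extended-real kernel values by reals, so that linear arithmetic applies to mixtures. *)
Lemma Gamma_itv (T : trans O) (l : L) (A : set L) : measurable A ->
  exists2 r : R, Gamma m T l A = r%:E & 0 <= r <= 1.
Proof.
move=> mA.
have le1 : (Gamma m T l A <= 1)%E.
  rewrite -(prob_kernel (s := Gamma m T) l).
  by apply: le_measure; [exact/mem_set|exact/mem_set|].
have fin : Gamma m T l A \is a fin_num.
  by rewrite ge0_fin_numE//; exact: le_lt_trans le1 (ltry _).
exists (fine (Gamma m T l A)); first by rewrite fineK.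
by rewrite fine_ge0//= -lee_fin fineK.
Qed.

Lemma Gamma_half_mix_le (S S' T T' : trans O) (p r : R) (l : L) (A : set L) :
  0 <= p <= 1 -> measurable A ->
  Gamma m (trans_mix (1 / 2) S S') l A = Gamma m (trans_mix (1 - p) T T') l A ->
  (Gamma m T l A <= r%:E)%E ->
  (Gamma m S l A <= (2 * ((1 - p) * r + p))%:E)%E.
Proof.
move=> p01 mA.
rewrite !Gamma_mix//; [|lra|lra].
have [s -> s01] := Gamma_itv S l mA; have [s' -> s'01] := Gamma_itv S' l mA.
have [t -> t01] := Gamma_itv T l mA; have [t' -> t'01] := Gamma_itv T' l mA.
rewrite -!EFinM -!EFinD !lee_fin => -[E] tr.
have : (1 - p) * t <= (1 - p) * r by apply: ler_wpM2l => //; lra.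
have : p * t' <= p * 1 by apply: ler_wpM2l => //; lra.
lra.
Qed.

End model.

Theorem theorem2 (R : realType) (O : operational_theory R)
    (P : prep O) (M : meas O) (finM : finite_set [set: outcome M])
    (a : outcome M -> R) (a_gt0 : forall k : outcome M, 0 < a k)
    (Tt Tt1 Tt2 : trans O) (TtE : Tt = trans_comp Tt2 Tt1)
    (Ttstar Tt2star T1' T2' : trans O) (pd1 pd2 : R)
    (pd1_itv : 0 <= pd1 <= 1) (pd2_itv : 0 <= pd2 <= 1)
    (equiv1 : trans_equiv (trans_mix (1 / 2) Tt Ttstar) (trans_mix (1 - pd1) Tt2 T1'))
    (equiv2 : trans_equiv (trans_mix (1 / 2) Tt2 Tt2star)
                          (trans_mix (1 - pd2) (id_trans O) T2'))
    (d : measure_display) (L : measurableType d) (m : ontological_model O L)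
    (ncm : noncontextual m) :
  let amax := obs_max a in
  let bminus := pd1 + 3 * pd2 - 3 * pd1 * pd2 in
  let bplus := pd1 + 2 * pd2 - 2 * pd1 * pd2 in
  - 4 * amax * bminus <= obs_change a Tt P <= 2 * amax * bplus.
Proof.
pose amax := obs_max a.
pose bminus := pd1 + 3 * pd2 - 3 * pd1 * pd2.
pose bplus := pd1 + 2 * pd2 - 2 * pd1 * pd2.
suff : - 4 * amax * bminus <= obs_change a Tt P <= 2 * amax * bplus by [].
pose s : seq (outcome M) := fset_set [set: outcome M].
have ins k : k \in s by rewrite in_fset_set// in_setT.
pose f (l : L) : R := \sum_(k <- s) a k * xi m k l.
have a0 k : 0 <= a k by exact: ltW.
have xi0 k l : 0 <= xi m k l by have /andP[] := xi_itv m k l.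
have mf : measurable_fun [set: L] f.
  apply: measurable_sum => k; apply: measurable_funM; last exact: xi_measurable.
  exact: measurable_cst.
have a_amax k : a k <= amax.
  rewrite /amax /obs_max; apply: le_bigmax_seq => //.
  (* The maximum ranges only over indices where [a] differs from the default 0; [a_gt0] places every
     [k] among them. *)
  rewrite in_finite_support; last exact: finite_setIl.
  by apply/mem_set; split=> //=; apply/eqP; rewrite gt_eqF.
have f_itv l : 0 <= f l <= amax.
  apply/andP; split; first by apply: sumr_ge0 => k _; rewrite mulr_ge0.
  have xi1 : \sum_(k <- s) xi m k l = 1.
    apply: EFin_inj; rewrite -(xi_sum1 m M l) esum_fset//; last first.
      by move=> k _; rewrite lee_fin.
    by rewrite fsbig_finite// sumEFin.
  (* The response functions sum to 1, so [f l] is a weighted average of the [a k]. *)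
  rewrite -[amax]mulr1 -xi1 mulr_sumr; apply: ler_sum => k _.
  by rewrite ler_wpM2r.
have fE l : ((f l)%:E = \sum_(k <- s) (a k)%:E * (xi m k l)%:E)%E.
  by rewrite -sumEFin; apply: eq_bigr => k _; rewrite EFinM.
have mxi (k : outcome M) : measurable_fun [set: L] (fun l => (xi m k l)%:E).
  by apply/measurable_EFinP; exact: xi_measurable.
pose F (l : L) := (\int[Gamma m Tt l]_l' (f l')%:E)%E.
have mFg (g : L -> R) : measurable_fun [set: L] g -> (forall l, 0 <= g l) ->
    measurable_fun [set: L] (fun l => \int[Gamma m Tt l]_l' (g l')%:E)%E.
  move=> mg g0; apply: measurable_fun_integral_kernel.
  - by move=> U; exact: measurable_kernel.
  - by move=> l; rewrite lee_fin.
  - exact/measurable_EFinP.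
have f0 l : 0 <= f l by have /andP[] := f_itv l.
(* Integrated against [mu m P], [f] and [F] give the expectation of the observable without and with
   [Tt]. *)
have fint : (\int[mu m P]_l (f l)%:E = (\sum_(k <- s) a k * prob O k P)%:E)%E.
  under eq_integral do rewrite fE.
  rewrite ge0_integral_wsum//; last by move=> k l; rewrite lee_fin.
  rewrite -sumEFin; apply: eq_bigr => k _.
  by rewrite EFinM (reproduces_prob m).
have Fint : (\int[mu m P]_l F l = (\sum_(k <- s) a k * probT O k Tt P)%:E)%E.
  have FE l : F l = (\sum_(k <- s) (a k)%:E *
      \int[Gamma m Tt l]_l' (xi m k l')%:E)%E.
    rewrite /F; under eq_integral do rewrite fE.
    by rewrite ge0_integral_wsum// => k l'; rewrite lee_fin.
  under eq_integral do rewrite FE.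
  rewrite ge0_integral_wsum//.
  - rewrite -sumEFin; apply: eq_bigr => k _.
    by rewrite EFinM (reproduces_probT m).
  - by move=> k l; apply: integral_ge0 => l' _; rewrite lee_fin.
  - by move=> k; apply: mFg => //; exact: xi_measurable.
have [_ nc _] := ncm.
pose c := amax * (2 * bplus).
have near : {ae mu m P, forall l,
    (F l <= (f l)%:E + c%:E /\ (f l)%:E <= F l + c%:E)%E}.
  (* Each kernel equality holds off a null set; outside both, it holds at [l] for all measurable [A]
     at once. *)
  apply: filterS2 (nc _ _ equiv1 P) (nc _ _ equiv2 P) => l E1 E2.
  apply: integral_near_point => //; first exact: prob_kernel.
  move=> A mA Al.
  (* The 0 is the Dirac mass at [l] of a set avoiding [l]. Feeding [r = 2 * pd2] into the first
     equivalence then gives exactly [2 * bplus]. *)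
  have T2A : (Gamma m Tt2 l A <= (2 * ((1 - pd2) * 0 + pd2))%:E)%E.
    apply: (Gamma_half_mix_le pd2_itv mA (E2 A mA)).
    by rewrite Gamma_id// diracE memNset.
  apply: le_trans (Gamma_half_mix_le pd1_itv mA (E1 A mA) T2A) _.
  by rewrite lee_fin /bplus; lra.
have amax0 : 0 <= amax by exact: bigmax_ge_id.
(* The one nonlinear fact needed: [bplus] is [pd1 + 2 * pd2 * (1 - pd1)], and [2 * bminus - bplus]
   is [pd1 + 4 * pd2 * (1 - pd1)]. *)
have pd21 : 0 <= pd2 * (1 - pd1) by apply: mulr_ge0; lra.
have c0 : 0 <= c by rewrite /c mulr_ge0// mulr_ge0// /bplus; lra.
have F0 l : (0 <= F l)%E by apply: integral_ge0 => l' _; rewrite lee_fin.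
have mF : measurable_fun [set: L] F by exact: mFg.
have mEf : measurable_fun [set: L] (EFin \o f) by exact/measurable_EFinP.
have Ef0 l : (0 <= (EFin \o f) l)%E by rewrite lee_fin.
have up : (\int[mu m P]_l F l <= \int[mu m P]_l (f l)%:E + c%:E)%E.
  by apply: ae_ge0_le_integral_addr => //; apply: filterS near => l [].
have dn : (\int[mu m P]_l (f l)%:E <= \int[mu m P]_l F l + c%:E)%E.
  by apply: ae_ge0_le_integral_addr => //; apply: filterS near => l [].
move: up dn; rewrite fint Fint -!EFinD !lee_fin => up dn.
have -> : obs_change a Tt P
    = \sum_(k <- s) a k * probT O k Tt P - \sum_(k <- s) a k * prob O k P.
  rewrite /obs_change fsbig_finite// -sumrB.
  by apply: eq_bigr => k _; rewrite mulrBr.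
(* Weakens the symmetric lower bound [- 2 * amax * bplus] to the stated one. *)
have bpm : amax * bplus <= amax * (2 * bminus).
  apply: ler_wpM2l => //; rewrite /bplus /bminus; lra.
move: up dn bpm; rewrite /c; lra.
Qed.
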